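(* Let $S$ be a space-like surface in $\mathbb R^3_1$ without umbilical points, with principal curvatures $\nu_1,\nu_2$. If $S$ is a linear fractional space-like Weingarten surface, i.e. there are constants $A,B,C,D$ with $BC-AD\neq0$ such that $$\nu_1=\frac{A\nu_2+B}{C\nu_2+D},$$ then its invariants $K'=\nu_1\nu_2$, $H=\frac12(\nu_1+\nu_2)$, $H'=\frac12(\nu_1-\nu_2)$ satisfy a linear relation $$\delta K'=\alpha H+\beta H'+\gamma,\qquad \alpha,\beta,\gamma,\delta\ \text{constants},\quad \alpha^2-\beta^2+4\gamma\delta\neq0;$$ and vice versa, if the invariants of $S$ satisfy such a linear relation, then $S$ is a linear fractional space-like Weingarten surface.
   Context: $\mathbb R^3_1$ is three-dimensional Minkowski space with flat metric of signature $(2,1)$. A surface is space-like if its induced metric is positive definite. With unit normal $l$, $l^2=-1$, and principal parameters ($F=M=0$), $\nu_1=L/E$, $\nu_2=N/G$, where $E=z_u^2$, $F=z_uz_v$, $G=z_v^2$, $L=lz_{uu}$, $M=lz_{uv}$, $N=lz_{vv}$. The case $A=D$, $B=C=0$ (i.e. $\nu_1=\nu_2$), which characterizes umbilical points, is excluded. *)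

(* Defs.v *)
From HB Require Import structures.
From mathcomp Require Import all_boot all_order all_algebra.
From mathcomp Require Import all_classical all_reals all_analysis.
Set Implicit Arguments.
Unset Strict Implicit.
Unset Printing Implicit Defensive.
Import Order.TTheory GRing.Theory Num.Theory.
Import numFieldNormedType.Exports.
Local Open Scope classical_set_scope.
Local Open Scope ring_scope.

Definition minkowski_prod (R : realType) (x y : 'rV[R]_3) : R :=
  x 0 0 * y 0 0 + x 0 1 * y 0 1 - x 0 2 * y 0 2.

Definition du (R : realType) (f : R * R -> 'rV[R]_3) : R * R -> 'rV[R]_3 :=
  fun p => 'D_((1, 0) : R * R) f p.
Definition dv (R : realType) (f : R * R -> 'rV[R]_3) : R * R -> 'rV[R]_3 :=
  fun p => 'D_((0, 1) : R * R) f p.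

(* Intended for open U: the differentiation is in R * R, not within U. *)
Fixpoint class_C (R : realType) (k : nat) (U : set (R * R))
    (f : R * R -> 'rV[R]_3) : Prop :=
  (forall p, U p -> {for p, continuous f}) /\
  match k with
  | 0 => True
  | k'.+1 =>
      [/\ forall p, U p -> derivable f p ((1, 0) : R * R) /\
                           derivable f p ((0, 1) : R * R),
          class_C k' U (du f) & class_C k' U (dv f)]
  end.

Definition fundE (R : realType) (z : R * R -> 'rV[R]_3) (p : R * R) : R :=
  minkowski_prod (du z p) (du z p).
Definition fundF (R : realType) (z : R * R -> 'rV[R]_3) (p : R * R) : R :=
  minkowski_prod (du z p) (dv z p).
Definition fundG (R : realType) (z : R * R -> 'rV[R]_3) (p : R * R) : R :=
  minkowski_prod (dv z p) (dv z p).

Definition fundL (R : realType) (z l : R * R -> 'rV[R]_3) (p : R * R) : R :=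
  minkowski_prod (l p) (du (du z) p).
Definition fundM (R : realType) (z l : R * R -> 'rV[R]_3) (p : R * R) : R :=
  minkowski_prod (l p) (dv (du z) p).
Definition fundN (R : realType) (z l : R * R -> 'rV[R]_3) (p : R * R) : R :=
  minkowski_prod (l p) (dv (dv z) p).

(* Positive definiteness of the induced metric also makes z an immersion. *)
Definition spacelike (R : realType) (U : set (R * R))
    (z : R * R -> 'rV[R]_3) : Prop :=
  forall p, U p -> forall a b : R, (a, b) <> (0, 0) ->
    0 < fundE z p * a ^+ 2 + 2 * fundF z p * a * b + fundG z p * b ^+ 2.

Definition unit_normal (R : realType) (U : set (R * R))
    (z l : R * R -> 'rV[R]_3) : Prop :=
  forall p, U p ->
    [/\ {for p, continuous l}, minkowski_prod (l p) (l p) = -1,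
        minkowski_prod (l p) (du z p) = 0 & minkowski_prod (l p) (dv z p) = 0].

Definition principal_parameters (R : realType) (U : set (R * R))
    (z l : R * R -> 'rV[R]_3) : Prop :=
  forall p, U p -> fundF z p = 0 /\ fundM z l p = 0.

(* U is not required to be connected, so that a surface covered by countably
   many charts is included: place the chart domains disjointly in the plane.
   C^2 is the regularity needed for L, M and N; smooth surfaces qualify. *)
Definition spacelike_surface (R : realType) (U : set (R * R))
    (z l : R * R -> 'rV[R]_3) : Prop :=
  [/\ open U /\ U !=set0, class_C 2 U z, spacelike U z, unit_normal U z l &
      principal_parameters U z l].

Definition nu1 (R : realType) (z l : R * R -> 'rV[R]_3) (p : R * R) : R :=
  fundL z l p / fundE z p.
Definition nu2 (R : realType) (z l : R * R -> 'rV[R]_3) (p : R * R) : R :=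
  fundN z l p / fundG z p.

Definition umbilical (R : realType) (z l : R * R -> 'rV[R]_3) (p : R * R) :
    Prop := nu1 z l p = nu2 z l p.

Definition invK' (R : realType) (z l : R * R -> 'rV[R]_3) (p : R * R) : R :=
  nu1 z l p * nu2 z l p.
Definition invH (R : realType) (z l : R * R -> 'rV[R]_3) (p : R * R) : R :=
  2^-1 * (nu1 z l p + nu2 z l p).
Definition invH' (R : realType) (z l : R * R -> 'rV[R]_3) (p : R * R) : R :=
  2^-1 * (nu1 z l p - nu2 z l p).

(* The second conjunct excludes the identity map, i.e. nu1 = nu2. Since
   x / 0 = 0 here, the nonvanishing of the denominator has to be stated. *)
Definition linear_fractional_weingarten (R : realType) (U : set (R * R))
    (z l : R * R -> 'rV[R]_3) : Prop :=
  exists A B C D : R,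
    [/\ B * C - A * D <> 0,
        ~ [/\ A = D, B = 0 & C = 0] &
        forall p, U p ->
          C * nu2 z l p + D <> 0 /\
          nu1 z l p = (A * nu2 z l p + B) / (C * nu2 z l p + D)].

Definition linear_relation (R : realType) (U : set (R * R))
    (z l : R * R -> 'rV[R]_3) : Prop :=
  exists alpha beta gamma delta : R,
    alpha ^+ 2 - beta ^+ 2 + 4 * gamma * delta <> 0 /\
    forall p, U p ->
      delta * invK' z l p = alpha * invH z l p + beta * invH' z l p + gamma.

(* Main.v *)
Require Import Defs.
From HB Require Import structures.
From mathcomp Require Import all_boot all_order all_algebra.
From mathcomp Require Import all_classical all_reals all_analysis.
From mathcomp Require Import ring.
Import GRing.Theory Num.Theory.
Local Open Scope classical_set_scope.
Local Open Scope ring_scope.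

(** Write [x] and [y] for the two principal curvatures at a point. Clearing
    denominators in [x = (A y + B) / (C y + D)] gives
    [C x y + D x = A y + B], and since [x = H + H'] and [y = H - H'] this is
    the linear relation with coefficients
    [alpha = A - D], [beta = - (A + D)], [gamma = B], [delta = C], for which
    [alpha^2 - beta^2 + 4 gamma delta = 4 (B C - A D)]. The change of
    coefficients is invertible, so the converse only requires two more facts.
    The denominator [C y + D] cannot vanish: otherwise the cleared equation
    would make [A y + B] vanish too, forcing [B C - A D = 0]
    ([moebius_cleared]). The excluded identity map corresponds to
    [alpha = gamma = delta = 0] with [beta <> 0], i.e. to [H' = 0], which means
    that every point is umbilical; this is impossible on a (nonempty) surface
    without umbilical points. No differential geometry beyond this enters. *)

(** For a nondegenerate fractional linear map, the cleared equation already
    implies that the denominator does not vanish. *)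
Lemma moebius_cleared {F : fieldType} {a b c d : F} (x y : F) :
  b * c - a * d <> 0 ->
  (c * y + d <> 0 /\ x = (a * y + b) / (c * y + d)) <->
  x * (c * y + d) = a * y + b.
Proof.
move=> det_n0; split=> [[/eqP den_n0 ->]|eq_xy]; first by rewrite divfK.
have den_n0 : c * y + d != 0.
  apply/eqP => den0; apply: det_n0.
  (* Both a y + b and c y + d vanish, and the determinant is a combination
     of them. *)
  have -> : b * c - a * d = c * (a * y + b) - a * (c * y + d) by ring.
  by rewrite -eq_xy den0 !mulr0 subrr.
by split; [exact/eqP | rewrite -eq_xy mulfK].
Qed.

(** The cleared equation, rewritten in terms of the product, the half-sum and
    the half-difference of [x] and [y]. *)
Lemma moebius_cleared_linear (F : numFieldType) (a b c d x y : F) :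
  x * (c * y + d) = a * y + b <->
  c * (x * y) =
    (a - d) * (2^-1 * (x + y)) + - (a + d) * (2^-1 * (x - y)) + b.
Proof.
have -> : (a - d) * (2^-1 * (x + y)) + - (a + d) * (2^-1 * (x - y)) + b =
          a * y + b - d * x by field.
have -> : x * (c * y + d) = c * (x * y) + d * x by ring.
by split=> [<-|->]; rewrite ?addrK ?subrK.
Qed.

Theorem lemma5p1 (R : realType) (U : set (R * R)) (z l : R * R -> 'rV[R]_3)
    (hS : spacelike_surface U z l)
    (hU : forall p, U p -> ~ umbilical z l p) :
  linear_fractional_weingarten U z l <-> linear_relation U z l.
Proof.
split.
- case=> A [B [C [D [det_n0 _ rel]]]].
  exists (A - D), (- (A + D)), B, C; split=> [|p Up].
    have -> : (A - D) ^+ 2 - (- (A + D)) ^+ 2 + 4 * B * C =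
              4 * (B * C - A * D) by ring.
    by apply/eqP; rewrite mulf_neq0 ?pnatr_eq0 //; apply/eqP.
  by apply/moebius_cleared_linear/(moebius_cleared _ _ det_n0)/rel.
- case=> alpha [beta [gamma [delta [disc_n0 rel]]]].
  pose A := 2^-1 * (alpha - beta); pose D := - (2^-1 * (alpha + beta)).
  have alphaE : alpha = A - D by rewrite /A /D; field.
  have betaE : beta = - (A + D) by rewrite /A /D; field.
  have det_n0 : gamma * delta - A * D <> 0.
    move=> det0; apply: disc_n0.
    have -> : alpha ^+ 2 - beta ^+ 2 + 4 * gamma * delta =
              4 * (gamma * delta - A * D) by rewrite alphaE betaE; ring.
    by rewrite det0 mulr0.
  have cleared p : U p -> nu1 z l p * (delta * nu2 z l p + D) =
                          A * nu2 z l p + gamma.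
    by move=> Up; apply/moebius_cleared_linear; rewrite -alphaE -betaE; apply: rel.
  exists A, gamma, delta, D; split=> // [[AD gamma0 delta0]|p Up]; last first.
    exact/(moebius_cleared _ _ det_n0)/cleared.
  case: hS => -[_ [p Up]] _ _ _ _; apply: (hU p Up).
  have D_n0 : D != 0.
    by apply/eqP => D0; apply: det_n0; rewrite gamma0 D0 mul0r mulr0 subrr.
  have := cleared p Up.
  rewrite gamma0 delta0 AD mul0r add0r addr0 mulrC.
  exact: mulfI.
Qed.
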